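(* Let $D_{G_1}$ be the derivation with $a\mapsto a^2,\ b\mapsto a^2$, and let $D_{G_2}$ be the derivation with $a\mapsto ab,\ b\mapsto ab$. Then for any $n\ge 1$, $$(D_{G_2}D_{G_1})^n a=(D_{G_2}D_{G_1})^n b=n!\,(n+1)!\,a^{n+1}b^n\,N\!\left(A_{n-1},\frac{a}{b}\right),$$ which implies that $N(A_{n-1},x)$ is symmetric, i.e. $x^{n-1}N(A_{n-1},1/x)=N(A_{n-1},x)$.
   Context: A context-free grammar such as $G=\{a\to u(a,b),\ b\to v(a,b)\}$ defines the formal derivative $D_G$: the linear operator on polynomials in the commuting indeterminates $a,b$ satisfying $D_G(pq)=D_G(p)q+pD_G(q)$, $D_G(a)=u$, $D_G(b)=v$. $(D_{G_2}D_{G_1})^n$ is the $n$-th power of the composition (apply $D_{G_1}$ first, then $D_{G_2}$). The type $A$ Narayana polynomial is $$N(A_{n-1},x)=\sum_{k=0}^{n-1}\frac1n\binom{n}{k+1}\binom nk x^k .$$ *)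

(* Defs.v *)
From HB Require Import structures.
From mathcomp Require Import all_boot all_order all_algebra.
From mathcomp.multinomials Require Import mpoly.

Set Implicit Arguments.
Unset Strict Implicit.
Unset Printing Implicit Defensive.

Import GRing.Theory.
Local Open Scope ring_scope.

(* Embedding of a domain into its fraction field: makes sense of a/b and 1/x. *)
Notation "x %:F" := (tofrac x) : ring_scope.

(* The two letters of the grammars, as the indeterminates of {mpoly F[2]}. *)
Definition la (F : fieldType) : {mpoly F[2]} := 'X_(ord0 : 'I_2).
Definition lb (F : fieldType) : {mpoly F[2]} := 'X_(ord_max : 'I_2).

(* D is the formal derivative D_G of the grammar G = {a -> u, b -> v}.  Such a
   D exists and is unique, see formal_derivative_exists and
   formal_derivative_unique. *)
Definition formal_derivative (F : fieldType) (u v : {mpoly F[2]})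
    (D : {mpoly F[2]} -> {mpoly F[2]}) : Prop :=
  [/\ linear D,
      forall p q, D (p * q) = D p * q + p * D q,
      D (la F) = u
    & D (lb F) = v].

(* narayana F n is N(A_{n-1}, x), for n >= 1: the index is shifted by one. *)
Definition narayana (F : fieldType) (n : nat) : {poly F} :=
  \sum_(k < n) (n%:R^-1 * 'C(n, k.+1)%:R * 'C(n, k)%:R) *: 'X^k.

Lemma formal_derivative_exists (F : fieldType) (u v : {mpoly F[2]}) :
  exists D, formal_derivative u v D.
Proof.
exists (fun p => u * mderiv ord0 p + v * mderiv ord_max p); split.
- move=> c p q; rewrite !linearP /= !mulrDr -!scalerAr scalerDr.
  by rewrite addrACA.
- move=> p q; rewrite !mderivM !mulrDr !mulrDl addrACA; congr (_ + _ + (_ + _)).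
  + by rewrite mulrA.
  + by rewrite mulrA.
  + by rewrite mulrCA.
  + by rewrite mulrCA.
- rewrite /la !mderivX !mnm1E /= scale1r scale0r mulr0 addr0.
  by rewrite -[X in (X - _)%MM]add0m addmK mpolyX0 mulr1.
- rewrite /lb !mderivX !mnm1E /= scale1r scale0r mulr0 add0r.
  by rewrite -[X in (X - _)%MM]add0m addmK mpolyX0 mulr1.
Qed.

Lemma formal_derivative_unique (F : fieldType) (u v : {mpoly F[2]}) D D' :
  formal_derivative u v D -> formal_derivative u v D' -> D =1 D'.
Proof.
move=> [Dl DM Da Db] [Dl' DM' Da' Db'].
have lin0 E : linear E -> E 0 = 0 :> {mpoly F[2]}.
  move=> El; have := El (-1) 0 0.
  by rewrite scaler0 addr0 scaleN1r addNr.
have one0 E : (forall p q, E (p * q) = E p * q + p * E q) ->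
    E 1 = 0 :> {mpoly F[2]}.
  move=> EM; have := EM 1 1; rewrite !mulr1 mul1r => /eqP.
  by rewrite -subr_eq0 opprD addrA subrr sub0r oppr_eq0 => /eqP.
have eqX (x : {mpoly F[2]}) k : D x = D' x -> D (x ^+ k) = D' (x ^+ k).
  move=> ex; elim: k => [|k IH]; first by rewrite !expr0 !one0.
  by rewrite exprS DM DM' ex IH.
elim/mpolyind => [|c m p _ _ IH]; first by rewrite !lin0.
rewrite Dl Dl' IH mpolyXE_id; congr (_ *: _ + _).
rewrite big_ord_recl big_ord1 DM DM' !eqX //; last by rewrite -/(la F) Da Da'.
have -> : lift ord0 ord0 = ord_max :> 'I_2 by apply: val_inj.
by rewrite -/(lb F) Db Db'.
Qed.

(* Main.v *)
Require Import Defs.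
From HB Require Import structures.
From mathcomp Require Import all_boot all_order all_algebra.
From mathcomp.multinomials Require Import mpoly.
From mathcomp Require Import ring zify.

(** Every polynomial met when D1 and D2 are applied in turn to a letter is
    homogeneous, so it is a list of coefficients on a^(s+k) b^(r-k), and each
    derivation acts on such a list by a two-term recurrence.  The coefficients
    have a product form after D2 and, which makes the induction easy, also
    after D1.  For a letter x:
    - (D2 D1)^m x has, for m >= 1, the coefficient
      (m-1)! (m+1)! C(m,k) C(m,k+1)   on   a^(m+1+k) b^(m-k);
    - D1 (D2 D1)^m x has, for m >= 0, the coefficient
      m! (m+1)! C(m,k) C(m+1,k+1)     on   a^(m+2+k) b^(m-k).
    Passing from one line to the next is a single identity between products of
    two binomials ([odd_coef_rec], [even_coef_rec]).  Both letters have the same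
    image a^2 under D1, and this is the second list at m = 0, so the induction
    starts there and treats a and b at once ([D1_iter]).

    Since n! (n+1)! / n = (n-1)! (n+1)!, the first list at m = n is
    n! (n+1)! a^(n+1) b^n N(A_(n-1), a/b): pulling b^n inside the sum turns
    (a/b)^k into a^k b^(n-k).  The symmetry of N(A_(n-1), x) is
    C(n,k+1) C(n,k) = C(n,n-1-k) C(n,n-k), read on the reversed sum. *)

Set Implicit Arguments.
Unset Strict Implicit.
Unset Printing Implicit Defensive.

Import GRing.Theory.
Local Open Scope ring_scope.

(** * Coefficient identities *)

(** m! (m+1)! times a Narayana number, the division by m being absorbed in the
    first factorial so that the value is visibly a natural number. *)
Definition even_coef (m k : nat) : nat :=
  (m.-1`! * m.+1`! * ('C(m, k) * 'C(m, k.+1)))%N.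

Definition odd_coef (m k : nat) : nat :=
  (m`! * m.+1`! * ('C(m, k) * 'C(m.+1, k.+1)))%N.

Lemma even_coef_last (m : nat) : even_coef m m = 0.
Proof. by rewrite /even_coef (bin_small (ltnSn m)) !muln0. Qed.

Lemma odd_coef_last (m : nat) : odd_coef m m.+1 = 0.
Proof. by rewrite /odd_coef (bin_small (ltnSn m)) muln0. Qed.

Lemma odd_coef0 (m : nat) : (0 < m)%N ->
  odd_coef m 0 = (m.+1 * even_coef m 0)%N.
Proof.
by case: m => // m _; rewrite /odd_coef /even_coef !bin0 !bin1 !factS /=; ring.
Qed.

(** Divide by the common factor C(m,k+1); absorption turns what is left into
    m (C(m,k+1) + C(m,k+2)), and Pascal's rule concludes. *)
Lemma odd_coef_rec (m k : nat) : (0 < m)%N ->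
  odd_coef m k.+1 =
    ((m.+1 + k.+1) * even_coef m k.+1 + (m - k) * even_coef m k)%N.
Proof.
case: m => // m _; rewrite /odd_coef /even_coef /=.
have H : ((m.+2 + k.+1) * 'C(m.+1, k.+2) + (m.+1 - k) * 'C(m.+1, k) =
          m.+1 * 'C(m.+2, k.+2))%N.
  rewrite -mul_bin_left (binS m.+1) (addSnnS m.+1) mulnDl mul_bin_left -addnA.
  rewrite -mulnDl [RHS]mulnDr.
  case: (leqP k.+1 m.+1) => Hk; first by rewrite subnK.
  by rewrite (bin_small Hk) !muln0.
set c := 'C(m.+1, k.+1).
transitivity (m`! * m.+2`! * c * (m.+1 * 'C(m.+2, k.+2)))%N.
  by rewrite (factS m); ring.
by rewrite -H; ring.
Qed.

Lemma even_coef0 (n : nat) : even_coef n.+1 0 = (n.+2 * odd_coef n 0)%N.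
Proof. by rewrite /odd_coef /even_coef !bin0 !bin1 (factS n.+1) /=; ring. Qed.

(** Absorption replaces (n-k) C(n+1,k+1) by (k+2) C(n+1,k+2), after which both
    terms share the factor C(n+1,k+2).  The cofactor is (n+2) C(n+1,k+1), by
    absorption and Pascal's rule. *)
Lemma even_coef_rec (n k : nat) :
  even_coef n.+1 k.+1 =
    ((n.+2 + k.+1) * odd_coef n k.+1 + (n - k) * odd_coef n k)%N.
Proof.
rewrite /odd_coef /even_coef /=.
have H1 := mul_bin_left n.+1 k.+1; rewrite subSS in H1.
have H : ((n.+2 + k.+1) * 'C(n, k.+1) + k.+2 * 'C(n, k) =
          n.+2 * 'C(n.+1, k.+1))%N.
  rewrite binS mulnDl mul_bin_left mulnDr -addnA -mulnDl.
  case: (leqP k n) => Hk; last by rewrite (bin_small Hk) !muln0.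
  by rewrite !addnS subnK.
set c := 'C(n.+1, k.+2).
transitivity (n`! * n.+1`! * c * (n.+2 * 'C(n.+1, k.+1)))%N.
  by rewrite (factS n.+1) /c; ring.
rewrite -H.
transitivity (n`! * n.+1`! * ((n.+2 + k.+1) * 'C(n, k.+1) * c)
   + n`! * n.+1`! * 'C(n, k) * (k.+2 * c))%N; first by ring.
by rewrite /c H1; ring.
Qed.

(** * Action of the derivations on homogeneous sums *)

(** Collects terms after each M_k has been sent to a combination of M_k and
    M_(k+1), as D1 and D2 do to monomials.  The condition on q N keeps the result
    in the range of the original sum. *)
Lemma sum_shift (V : nmodType) (M : nat -> V) (p q f : nat -> nat) (N : nat) :
    f 0 = p 0 -> (forall k, f k.+1 = (p k.+1 + q k)%N) -> q N = 0 ->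
  \sum_(k < N.+1) (M k *+ p k + M k.+1 *+ q k) = \sum_(k < N.+1) M k *+ f k.
Proof.
move=> f0 fS qN; rewrite big_split /= [X in _ + X]big_ord_recr /= qN mulr0n addr0.
rewrite big_ord_recl [RHS]big_ord_recl f0 -addrA -big_split /=.
by congr (_ + _); apply: eq_bigr => k _; rewrite /bump /= add1n fS mulrnDr.
Qed.

Section Derivation.
Variables (F : fieldType) (u v : {mpoly F[2]}).
Variable D : {mpoly F[2]} -> {mpoly F[2]}.
Hypothesis D_der : formal_derivative u v D.

Let a := la F.
Let b := lb F.

Lemma derivation0 : D 0 = 0.
Proof.
have [Dl _ _ _] := D_der; have := Dl (-1) 0 0.
by rewrite scaler0 addr0 scaleN1r addNr.
Qed.

Lemma derivationD p q : D (p + q) = D p + D q.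
Proof. by have [Dl _ _ _] := D_der; have := Dl 1 p q; rewrite !scale1r. Qed.

Lemma derivationMn p k : D (p *+ k) = D p *+ k.
Proof.
elim: k => [|k IH]; first by rewrite !mulr0n derivation0.
by rewrite !mulrS derivationD IH.
Qed.

Lemma derivation_sum (I : Type) (r : seq I) (f : I -> {mpoly F[2]}) :
  D (\sum_(i <- r) f i) = \sum_(i <- r) D (f i).
Proof. exact: (big_morph D derivationD derivation0). Qed.

Lemma derivationX p k : D (p ^+ k) = (p ^+ k.-1 * D p) *+ k.
Proof.
have [_ DM _ _] := D_der.
elim: k => [|k IH].
  rewrite mulr0n expr0; have := DM 1 1; rewrite !mulr1 mul1r => /eqP.
  by rewrite -subr_eq0 opprD addrA subrr sub0r oppr_eq0 => /eqP.
rewrite exprS DM IH mulrnAr mulrA mulrS /= [D p * _]mulrC; congr (_ + _).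
by case: k {IH} => [|k]; rewrite ?mulr0n // -exprS.
Qed.

Lemma derivation_monomial i j :
  D (a ^+ i * b ^+ j) =
    (a ^+ i.-1 * b ^+ j * u) *+ i + (a ^+ i * b ^+ j.-1 * v) *+ j.
Proof.
have [_ DM Da Db] := D_der.
rewrite DM !derivationX Da Db mulrnAl mulrnAr; congr (_ *+ _ + _ *+ _); ring.
Qed.

End Derivation.

(** * The iteration of D2 after D1 *)

Section Iteration.
Variables (F : fieldType) (D1 D2 : {mpoly F[2]} -> {mpoly F[2]}).
Hypothesis D1_der : formal_derivative (la F ^+ 2) (la F ^+ 2) D1.
Hypothesis D2_der : formal_derivative (la F * lb F) (la F * lb F) D2.

Let a := la F.
Let b := lb F.

Definition even_stage (m : nat) : {mpoly F[2]} :=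
  \sum_(k < m.+1) (a ^+ (m.+1 + k) * b ^+ (m - k)) *+ even_coef m k.

(** The summand at k = m+1 is zero; it gives this sum the range of the next even
    stage, so that [sum_shift] applies to both derivations. *)
Definition odd_stage (m : nat) : {mpoly F[2]} :=
  \sum_(k < m.+2) (a ^+ (m.+2 + k) * b ^+ (m - k)) *+ odd_coef m k.

Lemma D1_even_stage (m : nat) : (0 < m)%N -> D1 (even_stage m) = odd_stage m.
Proof.
move=> m_gt0; rewrite /even_stage /odd_stage.
rewrite (derivation_sum D1_der) [RHS]big_ord_recr /=.
rewrite odd_coef_last mulr0n addr0.
rewrite -(@sum_shift _ (fun k => a ^+ (m.+2 + k) * b ^+ (m - k))
  (fun k => (m.+1 + k) * even_coef m k)%N (fun k => (m - k) * even_coef m k)%N).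
- apply: eq_bigr => k _.
  rewrite (derivationMn D1_der) (derivation_monomial D1_der) mulrnDl -!mulrnA.
  rewrite -subnS -/a -/b /=; congr (_ *+ _ + _ *+ _).
  + by rewrite mulrAC -exprD addn2 !addSn.
  + by rewrite mulrAC -exprD addn2 addnS !addSn.
- by rewrite odd_coef0 // addn0.
- by move=> k; rewrite odd_coef_rec.
- by rewrite subnn.
Qed.

Lemma D2_odd_stage (m : nat) : D2 (odd_stage m) = even_stage m.+1.
Proof.
rewrite /even_stage /odd_stage (derivation_sum D2_der).
rewrite -(@sum_shift _ (fun k => a ^+ (m.+2 + k) * b ^+ (m.+1 - k))
  (fun k => (m.+2 + k) * odd_coef m k)%N (fun k => (m - k) * odd_coef m k)%N).
- apply: eq_bigr => k _.
  rewrite (derivationMn D2_der) (derivation_monomial D2_der) mulrnDl -!mulrnA.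
  rewrite -/a -/b /=; congr (_ + _).
    (* Where the exponent m - k is truncated, the coefficient is zero. *)
    case: (leqP k m) => Hk; last first.
      have -> : k = m.+1 :> nat by have := ltn_ord k; lia.
      by rewrite odd_coef_last !muln0.
    congr (_ *+ _); rewrite subSn // [b ^+ _.+1]exprS.
    by rewrite !addSn ![a ^+ _.+1]exprS /=; ring.
  rewrite subSS; case: (posnP (m - k)%N) => [->|mk_gt0]; first by rewrite !mul0n.
  by congr (_ *+ _); rewrite -{2}(prednK mk_gt0) exprS addnS exprS; ring.
- by rewrite even_coef0 addn0.
- by move=> k; rewrite even_coef_rec.
- by rewrite odd_coef_last muln0.
Qed.

Lemma D1_iter (x : {mpoly F[2]}) (n : nat) : D1 x = a ^+ 2 ->
  D1 (iter n (D2 \o D1) x) = odd_stage n.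
Proof.
move=> D1x; elim: n => [|n IH] /=; last by rewrite IH D2_odd_stage D1_even_stage.
rewrite D1x /odd_stage big_ord_recl big_ord1 /odd_coef /=.
by rewrite subn0 expr0 mulr1 addn0 muln0 mulr0n addr0.
Qed.

Lemma iter_even_stage (x : {mpoly F[2]}) (n : nat) : D1 x = a ^+ 2 ->
  (0 < n)%N -> iter n (D2 \o D1) x = even_stage n.
Proof. by case: n => // n D1x _; rewrite /= D1_iter // D2_odd_stage. Qed.

End Iteration.

(** * Evaluation of the Narayana polynomial *)

Lemma horner_map_narayana (F : fieldType) (K : comNzRingType)
    (f : {rmorphism F -> K}) (n : nat) (x : K) :
  (map_poly f (narayana F n)).[x] =
  \sum_(k < n) f (n%:R^-1 * 'C(n, k.+1)%:R * 'C(n, k)%:R) * x ^+ k.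
Proof.
rewrite /narayana rmorph_sum /= horner_sum; apply: eq_bigr => k _.
by rewrite map_polyZ map_polyXn hornerZ hornerXn.
Qed.

Lemma even_coef_narayana (F : fieldType) (n k : nat) : (n%:R != 0 :> F) ->
  (n`! * n.+1`!)%:R * (n%:R^-1 * 'C(n, k.+1)%:R * 'C(n, k)%:R)
    = (even_coef n k)%:R :> F.
Proof.
case: n => [|n]; first by rewrite eqxx.
by move=> n_neq0; rewrite /even_coef factS !natrM /=; field; rewrite nat1r.
Qed.

(** The term of degree k of a polynomial in x/y, cleared of denominators. *)
Lemma dehomogenize_term (K : fieldType) (x y c d : K) (n k : nat) :
  y != 0 -> (k <= n)%N ->
  d * c * (x ^+ (n.+1 + k) * y ^+ (n - k)) =
    d * x ^+ n.+1 * y ^+ n * (c * (x / y) ^+ k).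
Proof.
move=> y_neq0 le_kn; rewrite expfB_cond ?(negbTE y_neq0) // exprD exprMn exprVn.
by ring.
Qed.

Theorem theorem15 (F : fieldType) (charF : [pchar F] =i pred0)
    (n : nat) (n_ge1 : (1 <= n)%N) :
  (forall D1 D2 : {mpoly F[2]} -> {mpoly F[2]},
     formal_derivative (la F ^+ 2) (la F ^+ 2) D1 ->
     formal_derivative (la F * lb F) (la F * lb F) D2 ->
     iter n (D2 \o D1) (la F) = iter n (D2 \o D1) (lb F) /\
     (iter n (D2 \o D1) (lb F))%:F =
       (n`! * n.+1`!)%:R * (la F)%:F ^+ n.+1 * (lb F)%:F ^+ n *
       (map_poly (fun c : F => (c%:MP_[2])%:F) (narayana F n)).[(la F)%:F / (lb F)%:F])
  /\
  ('X : {poly F})%:F ^+ n.-1 *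
    (map_poly (fun c : F => (c%:P)%:F) (narayana F n)).[('X : {poly F})%:F^-1]
  = (narayana F n)%:F.
Proof.
have n_neq0 : n%:R != 0 :> F by rewrite (pcharf0P _).1 // -lt0n.
split=> [D1 D2 D1_der D2_der|].
  have [_ _ D1a D1b] := D1_der.
  rewrite !(iter_even_stage D1_der D2_der) //; split=> //.
  rewrite (horner_map_narayana (@tofrac {mpoly F[2]} \o @mpolyC 2 F)) /=.
  rewrite mulr_sumr /even_stage rmorph_sum /=.
  rewrite big_ord_recr /= even_coef_last mulr0n rmorph0 addr0.
  apply: eq_bigr => k _.
  have b_neq0 : (lb F)%:F != 0 by rewrite tofrac_eq0 /lb -msize_poly_eq0 msizeX.
  rewrite rmorphMn rmorphM !rmorphXn /= -mulr_natl.
  rewrite -(rmorph_nat (@tofrac {mpoly F[2]} \o @mpolyC 2 F) (even_coef n k)).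
  rewrite -(even_coef_narayana k n_neq0) rmorphM rmorph_nat /=.
  by rewrite dehomogenize_term // ltnW.
rewrite (horner_map_narayana (@tofrac {poly F} \o @polyC F)) /=.
rewrite mulr_sumr /narayana rmorph_sum.
rewrite [RHS](reindex_inj rev_ord_inj) /=; apply: eq_bigr => k _.
have kn := ltn_ord k.
have X_neq0 : ('X : {poly F})%:F != 0 by rewrite tofrac_eq0 polyX_eq0.
(* Complementing both binomials exchanges the coefficients of degrees k and
   n-1-k. *)
rewrite -subSn // subSS -(bin_sub (ltnW kn)) -(bin_sub kn).
rewrite [X in X *: _]mulrAC -mul_polyC [RHS]rmorphM rmorphXn /= mulrCA.
congr (_ * _); rewrite exprVn -expfB_cond ?(negbTE X_neq0) /=; last by lia.
by congr (_ ^+ _); lia.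
Qed.
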